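(* Let $\mu^y$ be the posterior with negative log-likelihood $\Phi$ and normalization constant $Z$, and for each $N$ let $\Phi_N$ be a random surrogate for $\Phi$ with associated mean-based approximate posterior $\mu^{y,N}_{\mathrm{mean}}$ and normalization constant $Z_N^{\mathrm{mean}}$ (all as defined in the context). Suppose that there exist scalars $C_1 = C_1(p_1), C_2 \ge 0$, independent of $N$, such that for a Hölder-conjugate exponent pair $(p_1,p_1')$ we have, for all $N$, (i) $\left\| \exp\left(\Phi - \mathbb{E}[\Phi_N]\right) \right\|_{L^{p_1}_{\mu^y}(U)} \le C_1(p_1)$, where in the case $p_1=\infty$ the norm is the standard supremum norm $\|f\|_{L^\infty(U)} = \sup_{u\in U}|f(u)|$; (ii) $C_2^{-1} \le Z_N^{\mathrm{mean}} \le C_2$. Then there exists a constant $C = C(C_1,C_2,Z)$, independent of $N$, such that for all $N$ $$ d_{\mathrm{Hell}}\left(\mu^y, \mu^{y,N}_{\mathrm{mean}}\right) \le C \left\| \Phi - \mathbb{E}[\Phi_N] \right\|_{L^{2p_1'}_{\mu^y}(U)} . $$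
   Context: Setting (Bayesian inverse problem). $U$ is a separable Banach space, $\mathcal{G}: U \to \mathbb{R}^{d_y}$ is continuous, $\Gamma \in \mathbb{R}^{d_y\times d_y}$ is a symmetric positive definite matrix, $y \in \mathbb{R}^{d_y}$ is fixed data, and $\mu_0$ is a (prior) probability measure on $U$, $\mu_0(U)=1$. Put $\Phi(u) = \frac12 \|y - \mathcal{G}(u)\|_\Gamma^2$, where $\|x\|_\Gamma = \|\Gamma^{-1/2}x\|_2$. The posterior $\mu^y$ is the probability measure on $U$ given by $$\frac{d\mu^y}{d\mu_0}(u) = \frac1Z \exp(-\Phi(u)), \qquad Z = \mathbb{E}_{\mu_0}\left[\exp(-\Phi(u))\right].$$ Random surrogate. For each $N$, $\Phi_N$ is a random real-valued function on $U$; $\mathbb{E}$ denotes expectation with respect to the randomness in $\Phi_N$, and $\mathbb{E}[\Phi_N]$ denotes the function $u\mapsto \mathbb{E}[\Phi_N(u)]$ (assumed well defined and measurable). The mean-based approximation is the probability measure $$\frac{d\mu^{y,N}_{\mathrm{mean}}}{d\mu_0}(u) = \frac{1}{Z_N^{\mathrm{mean}}}\exp\left(-\mathbb{E}[\Phi_N(u)]\right),\qquad Z_N^{\mathrm{mean}} = \mathbb{E}_{\mu_0}\left[\exp\left(-\mathbb{E}[\Phi_N(u)]\right)\right].$$ Hellinger distance: $d_{\mathrm{Hell}}(\mu,\mu') = \left(\frac12\int_U \left(\sqrt{\frac{d\mu}{d\nu}} - \sqrt{\frac{d\mu'}{d\nu}}\right)^2 d\nu\right)^{1/2}$ for any measure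 $\nu$ with respect to which both $\mu$ and $\mu'$ are absolutely continuous (the value does not depend on $\nu$). $L^p_{\mu^y}(U)$ is the $L^p$ space on $U$ with respect to the measure $\mu^y$. Exponents $(p_1,p_1')$ are Hölder conjugate if $p_1,p_1'\in[1,\infty]$ and $1/p_1+1/p_1'=1$. *)

(* Defs.v *)
From HB Require Import structures.
From mathcomp Require Import all_boot all_order all_algebra.
From mathcomp Require Import all_classical all_reals all_analysis.
From mathcomp Require Import ring.
From mathcomp Require complex.
Import Order.TTheory GRing.Theory Num.Theory.
Import numFieldNormedType.Exports.

Set Implicit Arguments.
Unset Strict Implicit.
Unset Printing Implicit Defensive.

Local Open Scope classical_set_scope.
Local Open Scope ring_scope.

Definition separable (T : topologicalType) : Prop :=
  exists2 D : set T, countable D & dense D.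

Notation borel T := (g_sigma_algebraType (@open T)).

Section weighted_norm.
Context {R : realType} {n : nat}.
Implicit Types (A B S D : 'M[R]_n) (x : 'cV[R]_n).

Definition spdmx A : Prop :=
  A^T = A /\ forall x, x != 0 -> 0 < (x^T *m A *m x) 0 0.

Local Lemma spdmx_sylvester S D : spdmx S -> S *m D + D *m S = 0 ->
  D^T = D \/ D^T = - D -> D = 0.
Proof.
move=> [_ Spos] SD DT.
have tr0 : \tr (D *m S *m D) = 0.
  have E : D *m S *m D = - (S *m D *m D).
    by apply/eqP; rewrite -addr_eq0 -mulmxDl addrC SD mul0mx.
  have /eqP := congr1 mxtrace E.
  rewrite -mulmxA mxtrace_mulC raddfN /= -addr_eq0 -mulr2n mulrn_eq0 /=.
  by move=> /eqP.
have {}tr0 : \tr (D^T *m S *m D) = 0.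
  by case: DT => -> //; rewrite !mulNmx raddfN /= tr0 oppr0.
have diagE j : (D^T *m S *m D) j j = ((col j D)^T *m S *m col j D) 0 0.
  rewrite !mxE; apply: eq_bigr => k _; rewrite !mxE; congr (_ * _).
  by apply: eq_bigr => l _; rewrite !mxE.
have diag_ge0 j : 0 <= (D^T *m S *m D) j j.
  rewrite diagE; have [->|/Spos/ltW//] := eqVneq (col j D) 0.
  by rewrite mulmx0 mxE.
apply/matrixP => i j; rewrite mxE.
have /eqP := tr0; rewrite psumr_eq0 // => /allP /(_ j).
rewrite mem_index_enum => /(_ isT) /=.
rewrite diagE => /eqP Dj0; have [/colP/(_ i)|/Spos] := eqVneq (col j D) 0.
  by rewrite !mxE.
by rewrite Dj0 ltxx.
Qed.

Lemma spdmx_sqr_inj B D : spdmx B -> spdmx D -> B *m B = D *m D -> B = D.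
Proof.
move=> [BT Bpos] [DT Dpos] BD; apply/eqP; rewrite -subr_eq0; apply/eqP.
apply: (@spdmx_sylvester (B + D)).
- split; first by rewrite raddfD /= BT DT.
  by move=> x x0; rewrite mulmxDr mulmxDl mxE addr_gt0 ?Bpos ?Dpos.
- rewrite mulmxDl mulmxBl !mulmxBr !mulmxDr BD.
  move: (D *m D) (B *m D) (D *m B) => a b c.
  by apply/matrixP => i j; rewrite !mxE; ring.
- by left; rewrite raddfB /= BT DT.
Qed.

Import complex.
Local Notation C := (complex R).
Local Notation toC := (map_mx (real_complex R)).
Local Notation iC := (Complex 0 1 : C).
Local Notation hc M := (map_mx Num.conj M^T).

Local Lemma toC_inj m p (M M' N N' : 'M[R]_(m, p)) :
  toC M + iC *: toC N = toC M' + iC *: toC N' -> M = M' /\ N = N'.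
Proof.
move=> E; split; apply/matrixP => i j; have /matrixP/(_ i j) := E;
  rewrite !mxE /= => /eqP; rewrite eq_complex /= => /andP[/eqP + /eqP];
  by rewrite !(mul0r, mul1r, addr0, add0r, subr0).
Qed.

Local Lemma toC_split m p (V : 'M[C]_(m, p)) :
  V = toC (map_mx (@Re R) V) + iC *: toC (map_mx (@Im R) V).
Proof.
apply/matrixP => i j; rewrite !mxE /=; case: (V i j) => a b /=.
by apply/eqP; rewrite eq_complex /= !(mul0r, mul1r, mulr0, addr0, add0r, subr0) !eqxx.
Qed.

Local Lemma hc_split m p (X Y : 'M[R]_(m, p)) :
  hc (toC X + iC *: toC Y) = toC X^T - iC *: toC Y^T.
Proof.
apply/matrixP => i j; rewrite !mxE /=.
by apply/eqP; rewrite eq_complex /= !(mul0r, mul1r, mulr0, addr0, add0r, subr0, oppr0, opprD) !eqxx.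
Qed.

Local Definition hpd (M : 'M[C]_n) := forall v : 'cV[C]_n, v != 0 ->
  0 < (hc v *m M *m v) 0 0.

Local Lemma hpd_toC A : spdmx A -> hpd (toC A).
Proof.
move=> [AT Apos] v v0; rewrite (toC_split v) hc_split.
set x := map_mx _ v; set y := map_mx _ v.
have xy0 : (x != 0) || (y != 0).
  rewrite -negb_and; apply: contra v0 => /andP[/eqP x0 /eqP y0].
  by rewrite (toC_split v) -/x -/y x0 y0 !map_mx0 scaler0 addr0.
have yx : x^T *m A *m y = y^T *m A *m x.
  have tr : (y^T *m A *m x)^T = x^T *m A *m y.
    by rewrite !trmx_mul trmxK AT mulmxA.
  by apply/matrixP => i j; rewrite -tr mxE !ord1.
have iCC : iC * iC = -1 :> C by rewrite -expr2 sqr_i.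
have -> : (toC x^T - iC *: toC y^T) *m toC A *m (toC x + iC *: toC y) =
    toC (x^T *m A *m x + y^T *m A *m y).
  rewrite !mulmxBl !mulmxDr -!scalemxAl -!scalemxAr -!map_mxM yx scalerA iCC.
  rewrite map_mxD; move: (toC _) (toC _) (toC _) => a b c.
  by apply/matrixP => i j; rewrite !mxE; ring.
rewrite mxE ltcR mxE.
have pos (z : 'cV[R]_n) : 0 <= (z^T *m A *m z) 0 0.
  have [->|/Apos/ltW//] := eqVneq z 0; by rewrite mulmx0 mxE.
by case/orP: xy0 => /Apos ?; [apply: ltr_pwDl|apply: ltr_wpDl].
Qed.

Local Lemma hpd_spd (B : 'M[C]_n) : hc B = B -> hpd B ->
  spdmx (map_mx (@Re R) B).
Proof.
move=> Bh Bpos; split.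
  apply/matrixP => i j; have /matrixP/(_ j i) := Bh; rewrite !mxE.
  by case: (B i j) => a b; case: (B j i) => c d [].
move=> x x0; have v0 : toC x != 0.
  by apply: contra x0 => /eqP/matrixP E; apply/eqP/matrixP => i j;
    have /eqP := E i j; rewrite !mxE eq_complex => /andP[/eqP].
have := Bpos _ v0.
have -> : hc (toC x) = toC x^T.
  apply/matrixP => i j; rewrite !mxE; exact: conjc_real.
rewrite {1}(toC_split B) mulmxDr mulmxDl -scalemxAr -scalemxAl -!map_mxM.
rewrite !mxE ltcE /= => /andP[_].
by rewrite mul0r mul1r oppr0 !addr0 /= ?mxE.
Qed.

Lemma sqrtmx_ex A : spdmx A -> exists B, spdmx B /\ B *m B = A.
Proof.
move=> spdA; have [AT _] := spdA.
have hA : toC A \is hermsymmx.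
  apply/is_hermitianmxP; rewrite expr0 scale1r; apply/matrixP => i j.
  by rewrite !mxE /= -{1}AT mxE; apply/esym/conjc_real.
set P := spectralmx (toC A); set s := spectral_diag (toC A).
have PU : P \is unitarymx by exact: spectral_unitarymx.
have /orthomx_spectralP := hermitian_normalmx hA; rewrite -/P -/s => EA.
have Pinv : invmx P = hc P by rewrite invmx_unitary // map_trmx.
have PhP : P *m hc P = 1%:M by rewrite -Pinv mulmxV // spectral_unit.
have hPP : hc P *m P = 1%:M by rewrite -Pinv mulVmx // spectral_unit.
have hcM m p q (M : 'M[C]_(m, p)) (N : 'M[C]_(p, q)) : hc (M *m N) = hc N *m hc M.
  by rewrite trmx_mul map_mxM.
have hcK m p (M : 'M[C]_(m, p)) : hc (hc M) = M.
  by apply/matrixP => i j; rewrite !mxE conjCK.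
have s_gt0 i : 0 < s 0 i.
  pose v := col i (hc P).
  have v0 : v != 0.
    apply/eqP => v0; have /matrixP/(_ i 0) := congr1 (mulmx P) v0.
    rewrite mulmx0 [RHS]mxE => /eqP; apply/negP.
    have -> : (P *m v) i 0 = (P *m hc P) i i.
      by rewrite !mxE; apply: eq_bigr => k _; rewrite !mxE.
    by rewrite PhP mxE eqxx oner_eq0.
  suff -> : s 0 i = (hc v *m toC A *m v) 0 0 by exact: hpd_toC.
  have -> : (hc v *m toC A *m v) 0 0 = (P *m toC A *m hc P) i i.
    rewrite !mxE; apply: eq_bigr => k _; rewrite !mxE; congr (_ * _).
    by apply: eq_bigr => l _; rewrite !mxE conjCK.
  rewrite EA Pinv !mulmxA PhP mul1mx -mulmxA PhP mulmx1.
  by rewrite mxE eqxx.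
pose B := hc P *m diag_mx (map_mx sqrtC s) *m P.
have Bh : hc B = B.
  rewrite /B !hcM hcK mulmxA; congr (_ *m _ *m _).
  rewrite tr_diag_mx; apply/matrixP => i j; rewrite !mxE rmorphMn /=.
  by congr (_ *+ _); apply/CrealP/ger0_real; rewrite sqrtC_ge0 ltW.
have BB : B *m B = toC A.
  rewrite /B !mulmxA -[hc P *m _ *m P *m hc P]mulmxA PhP mulmx1.
  rewrite EA Pinv -[hc P *m _ *m diag_mx _]mulmxA; congr (_ *m _ *m _).
  rewrite mulmx_diag; congr diag_mx.
  by apply/rowP => i; rewrite !mxE -expr2 sqrtCK.
have Bpos : hpd B.
  move=> v v0; pose w := P *m v.
  have w0 : w != 0.
    apply: contra v0 => /eqP w0; apply/eqP.
    by rewrite -[v]mul1mx -hPP -mulmxA -/w w0 mulmx0.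
  have -> : hc v *m B *m v = hc w *m diag_mx (map_mx sqrtC s) *m w.
    by rewrite /B /w hcM !mulmxA.
  rewrite mxE; have [k wk] : exists k, w k 0 != 0.
    apply/existsP; apply: contraNT w0 => /existsPn wn; apply/eqP/colP => k.
    by rewrite [RHS]mxE; apply/eqP; have := wn k; rewrite negbK.
  have E j : (hc w *m diag_mx (map_mx sqrtC s)) 0 j * w j 0 =
      sqrtC (s 0 j) * (w j 0 * (w j 0)^* )%R.
    rewrite mul_mx_diag !mxE; ring.
  under eq_bigr do rewrite E.
  rewrite (bigD1 k) //= ltr_pwDl //.
    by rewrite mulr_gt0 ?sqrtC_gt0 // mul_conjC_gt0.
  by apply: sumr_ge0 => j _; rewrite mulr_ge0 ?mul_conjC_ge0 // sqrtC_ge0 ltW.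
clearbody B.
have spdX := hpd_spd Bh Bpos.
set X := map_mx _ B in spdX; set Y := map_mx (@Im R) B.
have BXY : B = toC X + iC *: toC Y by exact: toC_split.
have iCC : iC * iC = -1 :> C by rewrite -expr2 sqr_i.
have [] : X *m X - Y *m Y = A /\ X *m Y + Y *m X = 0.
  apply: toC_inj; rewrite map_mx0 scaler0 addr0 -BB BXY.
  rewrite !mulmxDl !mulmxDr -!scalemxAl -!scalemxAr -!map_mxM scalerA iCC.
  rewrite map_mxB map_mxD.
  move: (toC _) (toC _) (toC _) (toC _) => a b c d.
  by apply/matrixP => i j; rewrite !mxE; ring.
move=> XX XY; have Y0 : Y = 0.
  apply: (spdmx_sylvester spdX XY); right.
  apply/matrixP => i j; have /matrixP/(_ j i) := Bh; rewrite !mxE.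
  by case: (B i j) => a b; case: (B j i) => c d [_ <-].
by exists X; rewrite -XX Y0 mul0mx subr0.
Qed.

(* The symmetric positive definite square root; the default value 0 is never
   taken when A is symmetric positive definite, see sqrtmxP and sqrtmx_uniq. *)
Definition sqrtmx A : 'M[R]_n := xget 0 [set B | spdmx B /\ B *m B = A].

Lemma sqrtmxP A : spdmx A -> spdmx (sqrtmx A) /\ sqrtmx A *m sqrtmx A = A.
Proof.
move=> /sqrtmx_ex AB; rewrite /sqrtmx; case: xgetP => [B _ //|/=] nAB.
by case: AB => B /nAB.
Qed.

Lemma sqrtmx_uniq B : spdmx B -> sqrtmx (B *m B) = B.
Proof.
move=> spdB; rewrite /sqrtmx; case: xgetP => [D _ [spdD]|/(_ B) []//].
exact: spdmx_sqr_inj.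
Qed.

Definition norm2 x : R := Num.sqrt (\sum_i x i 0 ^+ 2).

(* |A^{-1/2} x|_2 *)
Definition wnorm A x : R := norm2 (invmx (sqrtmx A) *m x).

End weighted_norm.

Definition neg_log_lik {R : realType} {n : nat} {U : Type}
    (G : U -> 'cV[R]_n) (Gam : 'M[R]_n) (y : 'cV[R]_n) (u : U) : R :=
  2^-1 * wnorm Gam (y - G u) ^+ 2.

Section measures.
Context {d : measure_display} {U : measurableType d} {R : realType}.
Local Open Scope ereal_scope.
Local Open Scope charge_scope.

Definition normalizer (mu0 : probability U R) (Phi : U -> R) : \bar R :=
  'E_mu0[fun u => expR (- Phi u)].

(* d mu / d mu0 = exp (- Phi) / Z; Radon-Nikodym derivatives being unique only
   up to null sets, the equality is mu0-almost everywhere. *)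
Definition is_posterior (mu0 : probability U R) (Phi : U -> R)
    (mu : probability U R) : Prop :=
  mu `<< mu0 /\
  ae_eq mu0 setT ('d (charge_of_finite_measure mu) '/d mu0)
    (fun u => (expR (- Phi u) / fine (normalizer mu0 Phi))%:E).

(* Meaningful when mu and mu' are absolutely continuous w.r.t. nu, in which case
   the value does not depend on nu; sigma-finiteness of nu is what makes the
   densities exist. *)
Definition hellinger (nu : {sigma_finite_measure set U -> \bar R})
    (mu mu' : probability U R) : \bar R :=
  sqrte ((2^-1)%:E *
    \int[nu]_u (sqrte (('d (charge_of_finite_measure mu) '/d nu) u) -
                sqrte (('d (charge_of_finite_measure mu') '/d nu) u)) ^+ 2).

Definition sup_norm (f : U -> R) : \bar R :=
  ereal_sup (range (fun u => `|f u|%:E)).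

(* The L^p(mu) norm, except that for p = +oo the genuine supremum is taken
   instead of the mu-essential supremum 'N[mu]_+oo. *)
Definition Lsup_norm (mu : probability U R) (p : \bar R) (f : U -> R) : \bar R :=
  if p == +oo then sup_norm f else 'N[mu]_p[EFin \o f].

(* in \bar R, +oo^-1 = 0 *)
Definition hoelder_pair (p q : \bar R) : Prop :=
  [/\ 1 <= p, 1 <= q & p^-1 + q^-1 = 1].

End measures.

Definition mean_surrogate {R : realType} {d : measure_display}
    {W : measurableType d} {U : Type} (P : probability W R)
    (Phi : W -> U -> R) (u : U) : R :=
  fine 'E_P[fun w => Phi w u].

(* Main.v *)
(* With delta = Phi - E[Phi_N], the likelihood ratio d(muN)/d(muy) is (c t)^2,
   where t = exp(delta/2) and c^2 = Z/Z_N, so that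
   2 d_Hell^2 = |1 - c t|^2 in L^2(muy). Both 1 and c t are unit vectors there,
   and normalizing t costs at most a factor 2: |1 - c t|^2 <= 2 |1 - t|^2.
   Pointwise (1 - exp(delta/2))^2 <= delta^2/4 (1 + exp delta), and Hoelder's
   inequality bounds the integral by (1 + C1)/4 times the square of the
   L^(2 p1') norm of delta. *)
Require Import Defs.
From HB Require Import structures.
From mathcomp Require Import all_boot all_order all_algebra.
From mathcomp Require Import all_classical all_reals all_analysis.
From mathcomp Require Import measurable_realfun ess_sup_inf.
From mathcomp Require Import ring lra.
Import Order.TTheory GRing.Theory Num.Theory.
Import numFieldNormedType.Exports.

Set Implicit Arguments.
Unset Strict Implicit.
Unset Printing Implicit Defensive.

Local Open Scope classical_set_scope.
Local Open Scope ring_scope.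

(** * An elementary inequality for the exponential *)

(** With [y = x / 2], the tangent-line bounds for [exp] at [y] and [- y] give |1 - exp y| <= |y|
    max(1, exp y), and the square of the maximum is at most 1 + exp(2 y). *)
Lemma sqr_onem_expR_half_le (R : realType) (x : R) :
  (1 - expR (x / 2)) ^+ 2 <= x ^+ 2 / 4 * (1 + expR x).
Proof.
have bound (y : R) : (1 - expR y) ^+ 2 <= y ^+ 2 * (1 + expR y ^+ 2).
  have := expR_ge1Dx y; have := expR_ge1Dx (- y); have := expR_gt0 y.
  rewrite expRN; set e := expR y; set i := e^-1 => e0 h1 h2.
  have h3 : e - 1 <= y * e.
    have : e * (1 - y) <= e * i by rewrite ler_pM2l.
    by rewrite mulfV ?gt_eqF//; lra.
  have [y0|y0] := leP 0 y.
  - have : (e - 1) ^+ 2 <= (y * e) ^+ 2.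
      by apply: lerXn2r; rewrite ?nnegrE//; [lra|exact/mulr_ge0/ltW].
    by have := sqr_ge0 y; nra.
  - have : (1 - e) ^+ 2 <= (- y) ^+ 2.
      have e1 : e <= 1 by nra.
      by apply: lerXn2r; rewrite ?nnegrE; lra.
    by have := sqr_ge0 (y * e); nra.
have -> : x ^+ 2 / 4 = (x / 2) ^+ 2 by field.
have -> : expR x = expR (x / 2) ^+ 2 by rewrite -expRM_natl; congr expR; field.
exact: bound.
Qed.

(** * Densities, the likelihood ratio and the Hellinger distance *)

Section density.
Context {d : measure_display} {T : measurableType d} {R : realType}.
Local Open Scope ereal_scope.
Local Open Scope charge_scope.

(** Change of variables holds for the nonnegative version [Radon_Nikodym_SigmaFinite.f] of the
    density; the derivative of the associated charge agrees with it [mu]-almost everywhere, so the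
    integral is the same. *)
Lemma ge0_integral_Radon_Nikodym (nu : {finite_measure set T -> \bar R})
    (mu : {sigma_finite_measure set T -> \bar R}) (f : T -> \bar R) (E : set T) :
  nu `<< mu -> measurable E -> measurable_fun setT f -> (forall x, 0 <= f x) ->
  \int[nu]_(x in E) f x =
  \int[mu]_(x in E) (f x * ('d (charge_of_finite_measure nu) '/d mu) x).
Proof.
move=> numu mE mf f0; have mfE : measurable_fun E f by exact: measurable_funTS.
rewrite -(Radon_Nikodym_SigmaFinite.change_of_variables numu f0 mE mfE).
apply: ae_eq_integral => //.
- apply: emeasurable_funM => //; apply: measurable_funTS.
  exact: measurable_int (Radon_Nikodym_SigmaFinite.f_integrable numu).
- by apply: emeasurable_funM => //; exact: measurable_funTS.
- exact/ae_eqe_mul2l/ae_eq_Radon_Nikodym_SigmaFinite.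
Qed.

(** The formula also covers [fine (normalizer mu0 Phi) = 0], which is how [posterior_normalizer_gt0]
    can use it to refute that case. *)
Lemma posterior_integral (mu0 mu : probability T R) (Phi : T -> R)
    (f : T -> \bar R) (E : set T) :
  is_posterior mu0 Phi mu -> measurable_fun setT Phi ->
  measurable E -> measurable_fun setT f -> (forall x, 0 <= f x) ->
  \int[mu]_(x in E) f x =
  \int[mu0]_(x in E)
    (f x * (expR (- Phi x) / fine (normalizer mu0 Phi))%:E).
Proof.
move=> [mumu0 dens] mPhi mE mf f0.
rewrite (ge0_integral_Radon_Nikodym mumu0)//.
apply: ae_eq_integral => //.
- by apply: emeasurable_funM; exact: measurable_funTS.
- apply: emeasurable_funM; first exact: measurable_funTS.
  apply/measurable_EFinP/measurable_funTS/measurable_funM => //.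
  by apply: measurableT_comp => //; exact: measurableT_comp.
- exact/ae_eqe_mul2l/(ae_eq_subset (@subsetT _ E) dens).
Qed.

(* If the normalizer were 0 or infinite, dividing by its [fine] would make the
   density vanish. *)
Lemma posterior_normalizer_gt0 (mu0 mu : probability T R) (Phi : T -> R) :
  is_posterior mu0 Phi mu -> measurable_fun setT Phi ->
  (0 < fine (normalizer mu0 Phi))%R.
Proof.
move=> post mPhi; rewrite lt0r fine_ge0 ?andbT; last first.
  by apply: expectation_ge0 => x; exact: expR_ge0.
apply/eqP => Z0.
have : mu setT = \int[mu]_x 1 by rewrite integral_cst// mul1e.
rewrite probability_setT (posterior_integral (E := setT) post)// Z0.
under eq_integral do rewrite invr0 mulr0 mule0.
by rewrite integral0 => /eqP; rewrite onee_eq0.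
Qed.

(** Both sides become integrals against the common prior [mu0]; the two densities can be divided
    everywhere because exponentials and both normalizers are positive. *)
Lemma posterior_likelihood_ratio (mu0 mu mu' : probability T R)
    (Phi Psi : T -> R) (E : set T) :
  is_posterior mu0 Phi mu -> is_posterior mu0 Psi mu' ->
  measurable_fun setT Phi -> measurable_fun setT Psi -> measurable E ->
  mu' E = \int[mu]_(x in E)
    (fine (normalizer mu0 Phi) / fine (normalizer mu0 Psi) *
     expR (Phi x - Psi x))%:E.
Proof.
move=> post post' mPhi mPsi mE.
have Z0 := posterior_normalizer_gt0 post mPhi.
have Z'0 := posterior_normalizer_gt0 post' mPsi.
have -> : mu' E = \int[mu']_(x in E) 1 by rewrite integral_cst// mul1e.
rewrite (posterior_integral post')// (posterior_integral post)//; last 2 first.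
- apply/measurable_EFinP/measurable_funM => //.
  by apply: measurableT_comp => //; exact: measurable_funB.
- by move=> x; rewrite lee_fin mulr_ge0 ?expR_ge0// divr_ge0 ?ltW.
apply: eq_integral => x _; rewrite mul1e -EFinM; congr (_%:E).
have -> : (expR (- Psi x) = expR (Phi x - Psi x) * expR (- Phi x))%R.
  by rewrite -expRD; congr expR; ring.
by field; rewrite !gt_eqF.
Qed.

(** By the chain rule the density of [mu'] is [h] times that of [mu], so the density of [mu] factors
    out of the squared difference of roots and [nu] disappears. *)
Lemma hellinger_density (nu : {sigma_finite_measure set T -> \bar R})
    (mu mu' : probability T R) (h : T -> R) :
  mu `<< nu -> mu' `<< nu -> measurable_fun setT h -> (forall x, 0 <= h x)%R ->
  (forall E, measurable E -> mu' E = \int[mu]_(x in E) (h x)%:E) ->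
  hellinger nu mu mu' =
  sqrte ((2^-1)%:E * \int[mu]_x ((1 - Num.sqrt (h x)) ^+ 2)%:E).
Proof.
move=> munu mu'nu mh h0 muh; rewrite /hellinger; congr (sqrte (_ * _)).
set D := 'd (charge_of_finite_measure mu) '/d nu.
set D' := 'd (charge_of_finite_measure mu') '/d nu.
have mD : measurable_fun setT D.
  exact/measurable_int/Radon_Nikodym_integrable.
have mD' : measurable_fun setT D'.
  exact/measurable_int/Radon_Nikodym_integrable.
(* The chain rule, obtained by comparing integrals over all measurable sets. *)
have D'E : ae_eq nu setT D' (fun x => (h x)%:E * D x).
  apply: integral_ae_eq => //.
  - exact: Radon_Nikodym_integrable.
  - by apply: emeasurable_funM => //; exact/measurable_EFinP.
  - move=> E _ mE; rewrite -Radon_Nikodym_integral//.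
    rewrite -(ge0_integral_Radon_Nikodym munu)//; last exact/measurable_EFinP.
    exact: muh.
(* A derivative of a charge may be negative on a null set; agreement with the nonnegative version
   makes [D] the square of its root almost everywhere. *)
have D0 : ae_eq nu setT (Radon_Nikodym_SigmaFinite.f mu nu) D.
  exact: ae_eq_Radon_Nikodym_SigmaFinite.
have msqrt : measurable_fun setT (@Num.sqrt R).
  by apply: continuous_measurable_fun; exact: sqrt_continuous.
have mg : measurable_fun setT (fun x => (1 - Num.sqrt (h x)) ^+ 2)%R.
  by apply: measurable_funX; apply: measurable_funB => //; exact: measurableT_comp.
rewrite (ge0_integral_Radon_Nikodym munu)//; last 2 first.
- exact/measurable_EFinP.
- by move=> x; rewrite lee_fin sqr_ge0.
have fD x : D x = (fine (D x))%:E by rewrite fineK// Radon_Nikodym_fin_num.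
have fD' x : D' x = (fine (D' x))%:E by rewrite fineK// Radon_Nikodym_fin_num.
apply: ae_eq_integral => //.
- rewrite (_ : (fun _ => _) = (fun x =>
    ((Num.sqrt (fine (D x)) - Num.sqrt (fine (D' x))) ^+ 2)%:E)); last first.
    by apply/funext => x; rewrite fD fD'.
  apply/measurable_EFinP/measurable_funX/measurable_funB.
    by apply: measurableT_comp => //; exact: measurableT_comp.
  by apply: measurableT_comp => //; exact: measurableT_comp.
- by apply: emeasurable_funM => //; exact/measurable_EFinP.
apply: filterS2 D'E D0 => x /(_ I) D'x /(_ I) Dx _.
have : 0 <= D x by rewrite -Dx; exact: Radon_Nikodym_SigmaFinite.f_ge0.
rewrite -/D -/D' D'x fD; move: (fine (D x)) => r; rewrite lee_fin => r0.
rewrite -!EFinM /= -EFinD -EFinM; congr (_%:E).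
by rewrite sqrtrM// -[in RHS](sqr_sqrtr r0); ring.
Qed.

End density.

(** * Normalization in L^2 and a Hoelder estimate *)

Section probability.
Context {d : measure_display} {T : measurableType d} {R : realType}.
Variable mu : probability T R.
Local Open Scope ereal_scope.

(* In a Hilbert space, normalizing [t] at most multiplies its squared distance
   to the unit vector [1] by 2. *)
Lemma integral_sqr_onem_normalized_le (t : T -> R) (c : R) :
  measurable_fun setT t -> (forall x, 0 <= t x)%R -> (0 < c)%R ->
  \int[mu]_x ((c * t x) ^+ 2)%:E = 1 ->
  \int[mu]_x ((1 - c * t x) ^+ 2)%:E <=
  2%:E * \int[mu]_x ((1 - t x) ^+ 2)%:E.
Proof.
move=> mt t0 c0 ct1.
have int1 : mu.-integrable setT (fun=> 1 : \bar R).
  exact: (finite_measure_integrable_cst _ 1).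
have int_ct2 : mu.-integrable setT (fun x => ((c * t x) ^+ 2)%:E).
  apply/integrableP; split.
    by apply/measurable_EFinP/measurable_funX/measurable_funM.
  under eq_integral do rewrite gee0_abs ?lee_fin ?sqr_ge0//.
  by rewrite ct1 ltry.
have int_t2 : mu.-integrable setT (fun x => (t x ^+ 2)%:E).
  have -> : (fun x => (t x ^+ 2)%:E) = (fun x => (c ^- 2)%:E * ((c * t x) ^+ 2)%:E).
    by apply/funext => x; rewrite -EFinM; congr (_%:E); field; rewrite gt_eqF.
  exact: integrableZl.
have int_t : mu.-integrable setT (fun x => (t x)%:E).
  (* Domination: t <= 1 + t^2. *)
  apply: (le_integrable _ _ _ (integrableD _ int1 int_t2)) => //.
    exact/measurable_EFinP.
  move=> x _ /=; rewrite lee_fin ger0_norm// ger0_norm.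
    by have := sqr_ge0 (t x - 1); have := t0 x; nra.
  by rewrite addr_ge0// sqr_ge0.
pose m := fine (\int[mu]_x (t x)%:E).
have mE : \int[mu]_x (t x)%:E = m%:E by rewrite fineK// integrable_fin_num.
have m0 : (0 <= m)%R by apply/fine_ge0/integral_ge0 => x _; rewrite lee_fin.
have s2E : \int[mu]_x (t x ^+ 2)%:E = (c ^- 2)%:E.
  have : (c ^+ 2)%:E * \int[mu]_x (t x ^+ 2)%:E = 1.
    rewrite -integralZl// -ct1; apply: eq_integral => x _.
    by rewrite -EFinM exprMn.
  move: (integrable_fin_num measurableT int_t2) => /fineK <-.
  move: (fine _) => r; rewrite -EFinM => -[cr].
  have c2 : (c ^+ 2 != 0)%R by rewrite sqrf_eq0 gt_eqF.
  by congr (_%:E); apply: (mulfI c2); rewrite cr mulfV.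
(* The expansion of |1 - k t|^2 in L^2, needed for [k = 1] and [k = c]. *)
have sqrE (k : R) : \int[mu]_x ((1 - k * t x) ^+ 2)%:E =
    (1 - 2 * k * m + k ^+ 2 * c ^- 2)%:E.
  have -> : (fun x => ((1 - k * t x) ^+ 2)%:E) =
      ((fun=> 1) \+ (fun x => (- (2 * k))%:E * (t x)%:E)) \+
      (fun x => (k ^+ 2)%:E * (t x ^+ 2)%:E).
    by apply/funext => x /=; rewrite -!EFinM -!EFinD; congr (_%:E); ring.
  rewrite integralD//; last 2 first.
  - by apply: integrableD => //; exact: integrableZl.
  - exact: integrableZl.
  rewrite integralD//; last exact: integrableZl.
  rewrite !integralZl// mE s2E integral_cst// mul1e.
  rewrite [X in X + _ + _]probability_setT -!EFinM -!EFinD; congr (_%:E); ring.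
have := sqrE 1%R; under eq_integral do rewrite mul1r; move=> ->.
have : 0 <= \int[mu]_x ((1 - c * t x) ^+ 2)%:E.
  by apply: integral_ge0 => x _; rewrite lee_fin sqr_ge0.
rewrite !sqrE -EFinM !lee_fin mulfV ?sqrf_eq0 ?gt_eqF// expr1n -exprVn.
(* Here [s] is the L^2 norm of [t] and [u] the cosine of its angle with 1. The case [k = c] gives u
   <= 1, and (u - s)^2 >= 0 yields 1 - 2 u s + s^2 >= 1 - u^2 >= 1 - u. *)
rewrite -(mulrA 2%R c) mulr1; set s := (c^-1)%R; set u := (c * m)%R => u1.
have -> : m = (u * s)%R by rewrite /u /s mulrAC mulfV ?mul1r ?gt_eqF.
have u0 : (0 <= u)%R by rewrite mulr_ge0// ltW.
by have := sqr_ge0 (u - s); nra.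
Qed.

(** This makes an unweighted square the case [g = 1] of the Hoelder estimate below, with the same
    exponent pair. *)
Lemma Lsup_norm_cst1_le (p : \bar R) : 1 <= p ->
  Lsup_norm mu p (cst 1%R) <= 1.
Proof.
rewrite /Lsup_norm; case: p => [p||]// p1; last first.
  by rewrite eqxx; apply: ge_ereal_sup => _ [x _ <-]; rewrite /= normr1.
rewrite (_ : EFin \o cst 1%R = cst 1)// Lnorm_cst1.
by rewrite [X in X `^ _]probability_setT poweR1r.
Qed.

(** Hoelder's inequality for f^2 and g, since the L^q norm of f^2 is the squared L^(2q) norm of f.
    The endpoints [p = +oo] and [q = +oo] are treated directly, the first with the genuine
    supremum. *)
Lemma integral_sqr_mul_le (p q : \bar R) (f g : T -> R) (r C : R) :
  hoelder_pair p q -> measurable_fun setT f -> measurable_fun setT g ->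
  (forall x, 0 <= g x)%R ->
  'N[mu]_(2%:E * q)[EFin \o f] = r%:E -> Lsup_norm mu p g <= C%:E ->
  \int[mu]_x (f x ^+ 2 * g x)%:E <= (r ^+ 2 * C)%:E.
Proof.
move=> [p1 q1 pq] mf mg g0 Nf Ng.
have r0 : (0 <= r)%R by rewrite -lee_fin -Nf Lnorm_ge0.
have mf2 : measurable_fun setT (fun x => f x ^+ 2)%R by exact: measurable_funX.
have f20 x : (0 <= f x ^+ 2)%R by exact: sqr_ge0.
have fpow (k : R) : q = k%:E -> (1 <= k)%R ->
    \int[mu]_x ((f x ^+ 2) `^ k)%:E = ((r ^+ 2) `^ k)%:E.
  move=> qk k1; have k0 : (k != 0)%R by rewrite gt_eqF// (lt_le_trans _ k1).
  have sqr_powR (s : R) : (`|s| `^ (2 * k) = (s ^+ 2) `^ k)%R.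
    by rewrite powRrM powR_mulrn// real_normK// num_real.
  rewrite -sqr_powR -poweR_EFin ger0_norm// -Nf qk -EFinM.
  rewrite poweR_Lnorm ?mulf_neq0//.
  by apply: eq_integral => x _; rewrite /= sqr_powR.
case: p p1 pq Ng => [p||]// p1 pq Ng; last first.
  have {}q1 : q = 1 by apply/eqP; rewrite -inve_eq1 -pq invey add0e.
  have gC x : (g x <= C)%R.
    rewrite -lee_fin; apply: le_trans Ng; rewrite /Lsup_norm eqxx.
    by apply: ereal_sup_ubound; exists x => //; rewrite ger0_norm.
  have fr : \int[mu]_x (f x ^+ 2)%:E = (r ^+ 2)%:E.
    have := fpow 1%R q1 (lexx _); rewrite powRr1 ?sqr_ge0// => <-.
    by apply: eq_integral => x _; rewrite powRr1.
  (* A space carrying a probability has a point, where 0 <= g <= C. *)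
  have C0 : (0 <= C)%R.
    have [T0|/set0P[x _]] := eqVneq [set: T] set0; last exact: le_trans (gC x).
    by have /eqP := probability_setT mu; rewrite T0 measure0 eq_sym onee_eq0.
  rewrite mulrC EFinM -fr -ge0_integralZl_EFin//; last 2 first.
  - by move=> x _; rewrite lee_fin.
  - exact/measurable_EFinP.
  apply: ge0_le_integral => //=.
  - by move=> x _; rewrite lee_fin mulr_ge0.
  - exact/measurable_EFinP/measurable_funM.
  - exact/measurable_EFinP/measurable_funM.
  - by move=> x _; rewrite -EFinM lee_fin mulrC ler_wpM2r.
rewrite /Lsup_norm /= in Ng.
have p0 : (0 < p)%R by rewrite -lte_fin (lt_le_trans _ p1).
case: q q1 pq Nf fpow => [q||]// q1 pq Nf fpow; last first.
  have {}p1 : p = 1%R.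
    by move/eqP: pq; rewrite invey adde0 inve_eq1 eqe => /eqP.
  have /ess_supP : ess_sup mu (abse \o (EFin \o f)) <= r%:E.
    (* The exponent 2 q is [+oo], and the essential supremum is the value of the norm because the
       total mass is positive. *)
    rewrite -Nf gt0_muley// unlock ifT//.
    by rewrite [X in _ < X]probability_setT.
  move=> fr; move: Ng; rewrite p1 Lnorm1.
  under eq_integral do rewrite /= ger0_norm//.
  move=> Ng.
  apply: (@le_trans _ _ (\int[mu]_x ((r ^+ 2)%:E * (g x)%:E))).
    apply: ae_ge0_le_integral => //=.
    - by move=> x _; rewrite lee_fin mulr_ge0.
    - exact/measurable_EFinP/measurable_funM.
    - by move=> x _; rewrite -EFinM lee_fin mulr_ge0// sqr_ge0.
    - exact/measurable_EFinP/measurable_funM.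
    - apply: filterS fr => x; rewrite /= lee_fin => fr _.
      rewrite -EFinM lee_fin ler_wpM2r// -real_normK ?num_real//.
      by apply: lerXn2r; rewrite ?nnegrE.
  rewrite ge0_integralZl_EFin ?sqr_ge0//; last 2 first.
  - by move=> x _; rewrite lee_fin.
  - exact/measurable_EFinP.
  by rewrite [leRHS]EFinM; apply: lee_wpmul2l; rewrite ?lee_fin ?sqr_ge0.
rewrite lee_fin in q1.
have q0 : (0 < q)%R by rewrite (lt_le_trans _ q1).
have pqR : (q^-1 + p^-1 = 1)%R.
  by move: pq; rewrite !inver !gt_eqF// -EFinD addrC => -[].
rewrite (_ : \int[mu]_x _ = 'N[mu]_1[EFin \o ((fun x => f x ^+ 2) \* g)%R]); last first.
  by rewrite Lnorm1; apply: eq_integral => x _; rewrite /= ger0_norm// mulr_ge0.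
apply: (le_trans (hoelder mu mf2 mg q0 p0 pqR)).
have -> : 'N[mu]_q%:E[EFin \o (fun x => f x ^+ 2)%R] = (r ^+ 2)%:E.
  rewrite unlock; under eq_integral do rewrite /= ger0_norm//.
  by rewrite (fpow q)// poweR_EFin -powRrM mulfV ?gt_eqF// powRr1// sqr_ge0.
by rewrite [leRHS]EFinM; apply: lee_wpmul2l; rewrite ?lee_fin ?sqr_ge0.
Qed.

End probability.

(** * The estimate for two potentials over a common prior *)

(** The surrogate enters only through its mean, so two deterministic potentials suffice; the
    constant involves only [C], which gives uniformity in N. *)
Lemma hellinger_posterior_le {d : measure_display} {T : measurableType d}
    {R : realType} (mu0 mu mu' : probability T R) (Phi Psi : T -> R)
    (p q : \bar R) (C : R) (nu : {sigma_finite_measure set T -> \bar R}) :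
  is_posterior mu0 Phi mu -> is_posterior mu0 Psi mu' ->
  measurable_fun setT Phi -> measurable_fun setT Psi ->
  0 <= C -> hoelder_pair p q ->
  (Lsup_norm mu p (fun u => expR (Phi u - Psi u)%R) <= C%:E)%E ->
  mu `<< nu -> mu' `<< nu ->
  (hellinger nu mu mu' <= (Num.sqrt (1 + C) / 2)%:E *
    'N[mu]_(2%:E * q)[(fun u => (Phi u - Psi u)%:E)])%E.
Proof.
move=> post post' mPhi mPsi C0 pq hC munu mu'nu.
have C10 : 0 < Num.sqrt (1 + C) by rewrite sqrtr_gt0 ltr_pwDl.
set N := Lnorm _ _ _.
have N0 : (0 <= N)%E by exact: Lnorm_ge0.
(* If the norm is infinite, so is the right-hand side, its constant being positive. *)
have [Ny|] := eqVneq N +oo%E.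
  by rewrite Ny gt0_muley ?leey// lte_fin divr_gt0.
rewrite -ltey -ge0_fin_numE// => /fineK; set r := fine N => /esym Nr.
have r0 : 0 <= r by rewrite fine_ge0.
pose delta u := Phi u - Psi u; pose t u := expR (delta u / 2).
pose Z := fine (normalizer mu0 Phi); pose Z' := fine (normalizer mu0 Psi).
have Z0 : 0 < Z := posterior_normalizer_gt0 post mPhi.
have Z'0 : 0 < Z' := posterior_normalizer_gt0 post' mPsi.
pose c := Num.sqrt (Z / Z').
have c0 : 0 < c by rewrite sqrtr_gt0 divr_gt0.
have mdelta : measurable_fun setT delta by exact: measurable_funB.
have mexp : measurable_fun setT (fun u => expR (delta u)) by exact: measurableT_comp.
have mt : measurable_fun setT t.
  by apply: measurableT_comp => //; exact: measurable_funM.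
have t2E u : t u ^+ 2 = expR (delta u).
  by rewrite -expRM_natl; congr expR; field.
have hE u : Z / Z' * expR (delta u) = (c * t u) ^+ 2.
  by rewrite exprMn t2E sqr_sqrtr// ltW// divr_gt0.
have density E : measurable E ->
    mu' E = (\int[mu]_(x in E) ((c * t x) ^+ 2)%:E)%E.
  move=> mE; rewrite (posterior_likelihood_ratio post post')//.
  by apply: eq_integral => x _; rewrite -hE.
rewrite (hellinger_density munu mu'nu _ _ density); last 2 first.
- exact/measurable_funX/measurable_funM.
- by move=> u; exact: sqr_ge0.
have dist_le : (\int[mu]_x ((1 - t x) ^+ 2)%:E <= ((1 + C) * r ^+ 2 / 4)%:E)%E.
  (* The factor 1 is kept so that both terms have the form required by [integral_sqr_mul_le]. *)
  pose F u := (delta u ^+ 2 * 1)%R; pose G u := delta u ^+ 2 * expR (delta u).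
  have F0 u : 0 <= F u by rewrite mulr_ge0// sqr_ge0.
  have G0 u : 0 <= G u by rewrite mulr_ge0 ?sqr_ge0// expR_ge0.
  have mF : measurable_fun setT F by apply: measurable_funM => //; exact: measurable_funX.
  have mG : measurable_fun setT G by apply: measurable_funM => //; exact: measurable_funX.
  apply: (@le_trans _ _ (\int[mu]_x ((4^-1)%:E * ((F x)%:E + (G x)%:E)))%E).
    apply: ge0_le_integral => //=.
    - by move=> u _; rewrite lee_fin sqr_ge0.
    - by apply/measurable_EFinP/measurable_funX/measurable_funB.
    - by apply/measurable_EFinP/measurable_funM => //; exact: measurable_funD.
    - move=> u _; rewrite -EFinD -EFinM lee_fin.
      apply: (le_trans (sqr_onem_expR_half_le _)).
      by rewrite /F /G le_eqVlt; apply/orP; left; apply/eqP; field.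
  rewrite ge0_integralZl_EFin//; last 2 first.
  - by move=> u _; rewrite -EFinD lee_fin addr_ge0.
  - by apply/measurable_EFinP; exact: measurable_funD.
  rewrite ge0_integralD//; last 4 first.
  - by move=> u _; rewrite lee_fin.
  - exact/measurable_EFinP.
  - by move=> u _; rewrite lee_fin.
  - exact/measurable_EFinP.
  have IF : (\int[mu]_x (F x)%:E <= (r ^+ 2 * 1)%:E)%E.
    apply: (integral_sqr_mul_le pq mdelta _ _ Nr) => //.
    by apply: Lsup_norm_cst1_le; case: pq.
  have IG : (\int[mu]_x (G x)%:E <= (r ^+ 2 * C)%:E)%E.
    by apply: (integral_sqr_mul_le pq mdelta _ _ Nr) => // u; exact: expR_ge0.
  have -> : ((1 + C) * r ^+ 2 / 4)%:E =
      ((4^-1)%:E * ((r ^+ 2 * 1)%:E + (r ^+ 2 * C)%:E))%E.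
    by rewrite -EFinD -EFinM; congr (_%:E); field.
  by apply: lee_wpmul2l; rewrite ?lee_fin// leeD.
have tsqrt u : Num.sqrt ((c * t u) ^+ 2) = c * t u.
  by rewrite sqrtr_sqr ger0_norm// mulr_ge0 ?expR_ge0// ltW.
under eq_integral do rewrite tsqrt.
have -> : ((Num.sqrt (1 + C) / 2)%:E * N)%E = sqrte ((1 + C) * r ^+ 2 / 4)%:E.
  rewrite Nr -EFinM /=; congr (_%:E).
  have -> : (1 + C) * r ^+ 2 / 4 = (1 + C) * (r / 2) ^+ 2 by field.
  by rewrite sqrtrM ?addr_ge0// sqrtr_sqr ger0_norm ?divr_ge0//; field.
rewrite lee_sqrt; last first.
  by rewrite lee_fin divr_ge0// mulr_ge0 ?sqr_ge0// addr_ge0.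
(* The Hellinger factor 1/2 is set against the factor 2 lost in normalizing [t]. *)
have -> : ((1 + C) * r ^+ 2 / 4)%:E =
    ((2^-1)%:E * (2%:E * ((1 + C) * r ^+ 2 / 4)%:E))%E.
  by rewrite -!EFinM; congr (_%:E); field.
apply: lee_wpmul2l; first by rewrite lee_fin.
apply: (@le_trans _ _ (2%:E * \int[mu]_x ((1 - t x) ^+ 2)%:E)%E).
  apply: integral_sqr_onem_normalized_le => //.
    by move=> u; exact: expR_ge0.
  (* That [c * t] is a unit vector is the total mass 1 of [mu']. *)
  by rewrite -density// probability_setT.
by apply: lee_wpmul2l; rewrite ?lee_fin.
Qed.

(** * Borel measurability of the negative log-likelihood *)

Lemma continuous_measurable_borel {R : realType} (U : ptopologicalType)
    (f : U -> R) :
  continuous f -> measurable_fun setT (f : borel U -> R).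
Proof.
move=> /continuousP cf; apply: (measurability _ (RGenOpens.measurableE R)).
move=> _ [_ [a [b ->] <-]]; rewrite setTI.
by apply: sub_sigma_algebra; apply: cf; exact: interval_open.
Qed.

(** Written in coordinates, the potential is a finite sum of squares of linear combinations of the
    continuous real functions [G u j 0], up to additive constants inside the squares and the factor
    1/2. *)
Lemma measurable_neg_log_lik {R : realType} (U : ptopologicalType) (n : nat)
    (G : U -> 'cV[R]_n) (Gam : 'M[R]_n) (y : 'cV[R]_n) :
  continuous G -> measurable_fun setT (neg_log_lik G Gam y : borel U -> R).
Proof.
move=> cG.
have -> : neg_log_lik G Gam y = fun u => 2^-1 *
    \sum_i (\sum_j invmx (sqrtmx Gam) i j * (y j 0 - G u j 0)) ^+ 2.
  apply/funext => u; rewrite /neg_log_lik /wnorm /norm2 sqr_sqrtr.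
    by congr (_ * _); apply: eq_bigr => i _; rewrite mxE; congr (_ ^+ 2);
      apply: eq_bigr => j _; rewrite !mxE.
  by apply: sumr_ge0 => i _; exact: sqr_ge0.
apply: measurable_funM => //.
apply: measurable_sum => i; apply: measurable_funX.
apply: measurable_sum => j; apply: measurable_funM => //.
apply: measurable_funB => //; apply: continuous_measurable_borel => u.
by apply: (continuous_comp (g := fun M : 'cV_n => M j 0)) (cG u) _; exact: coord_continuous.
Qed.

Unset Implicit Arguments.

Theorem theorem1 (R : realType) :
  exists C : R -> R -> R -> R,
  forall (U : completeNormedModType R) (sepU : separable U)
    (dy : nat) (G : U -> 'cV[R]_dy) (contG : continuous G)
    (Gam : 'M[R]_dy) (spdGam : spdmx Gam) (y : 'cV[R]_dy)
    (mu0 : probability (borel U) R) (muy : probability (borel U) R)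
    (post_muy : is_posterior mu0 (neg_log_lik G Gam y) muy)
    (dW : nat -> measure_display) (W : forall N, measurableType (dW N))
    (P : forall N, probability (W N) R)
    (PhiN : forall N, W N -> U -> R)
    (PhiN_int : forall N u, (P N).-integrable setT (fun w => (PhiN N w u)%:E))
    (EPhiN_meas : forall N, measurable_fun setT
       (mean_surrogate (P N) (PhiN N) : borel U -> R))
    (muN : nat -> probability (borel U) R)
    (post_muN : forall N,
       is_posterior mu0 (mean_surrogate (P N) (PhiN N)) (muN N))
    (C1 C2 : R) (C1_ge0 : 0 <= C1) (C2_ge0 : 0 <= C2)
    (p1 p1' : \bar R) (p1_conj : hoelder_pair p1 p1')
    (hyp_i : forall N,
       (Lsup_norm muy p1 (fun u =>
          expR (neg_log_lik G Gam y u - mean_surrogate (P N) (PhiN N) u))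
        <= C1%:E)%E)
    (hyp_ii : forall N,
       ((C2^-1)%:E <= normalizer mu0 (mean_surrogate (P N) (PhiN N)) <= C2%:E)%E),
  forall (N : nat) (nu : {sigma_finite_measure set (borel U) -> \bar R}),
    muy `<< nu -> muN N `<< nu ->
    (hellinger nu muy (muN N) <=
       (C C1 C2 (fine (normalizer mu0 (neg_log_lik G Gam y))))%:E *
       'N[muy]_(2%:E * p1')[(fun u =>
         (neg_log_lik G Gam y u - mean_surrogate (P N) (PhiN N) u)%:E)])%E.
Proof.
(* The root of (1/2) * 2 * (1 + C1)/4: Hellinger factor, normalization loss and Hoelder bound. *)
exists (fun C1 _ _ => Num.sqrt (1 + C1) / 2).
move=> U sepU dy G contG Gam spdGam y mu0 muy post_muy dW W P PhiN PhiN_int.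
move=> EPhiN_meas muN post_muN C1 C2 C1_ge0 C2_ge0 p1 p1' p1_conj hyp_i hyp_ii.
move=> N nu muynu muNnu.
apply: (hellinger_posterior_le post_muy (post_muN N) _ (EPhiN_meas N)
  C1_ge0 p1_conj (hyp_i N) muynu muNnu).
exact: measurable_neg_log_lik.
Qed.
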